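(* Let $N(\omega,\Sigma)$ be the Gaussian probability measure on $\mathbb{R}^n$ with mean $\omega\in\mathbb{R}^n$ and covariance matrix $\Sigma$. For every lower set $T\subseteq\Pi_n$, $T[N(\omega,\Sigma)]$ is the zero measure if and only if $\Sigma=\Sigma_\pi$ for some $\pi\in T\setminus\{\hat{\mathbf{1}}_n\}$.
   Context: $\Pi_n$ denotes the set of all partitions of $\{1,\dots,n\}$ into nonempty disjoint blocks, ordered by refinement: $\pi\le\sigma$ iff every block of $\pi$ is contained in a block of $\sigma$; $\hat{\mathbf{0}}_n$ is the partition into singletons and $\hat{\mathbf{1}}_n$ the one-block partition. A lower set of $\Pi_n$ is a subset $T$ containing $\hat{\mathbf 0}_n$ and $\hat{\mathbf 1}_n$ such that $w\in T\setminus\{\hat{\mathbf 1}_n\}$, $z\in\Pi_n$, $z\le w$ imply $z\in T$. With the induced order, $\mu$ is the M\''obius function of the poset $T$: $\mu(x,x)=1$, $\mu(x,y)=-\sum_{z\in T,\,x\le z<y}\mu(x,z)$ for $x<y$ in $T$, $0$ otherwise. For a Borel probability measure $P$ on $\mathbb{R}^n$ and nonempty $F\subseteq\{1,\dots,n\}$, $P_F$ is the marginal of $P$ on $\mathbb{R}^F$; for $\pi=(F_1,\dots,F_\ell)$, $P_\pi:=P_{F_1}\times\cdots\times P_{F_\ell}$, viewed as a measure on $\mathbb{R}^n$; $T[P]:=\sum_{\pi\in T}\mu(\pi,\hat{\mathbf{1}}_n)P_\pi$. The measure $N(\omega,\Sigma)$ has Fourier transform $\int e^{-i\langle x,\xi\rangle}dN(\omega,\Sigma)(\xi)=e^{-i\langle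 x,\omega\rangle-\langle\Sigma x,x\rangle/2}$. For a partition $\pi$, $\Sigma_\pi$ is the matrix obtained from $\Sigma$ by keeping the entries $\Sigma_{ij}$ with $i,j$ in the same block of $\pi$ and setting the entries with $i,j$ in different blocks to zero. *)

(* Defs.v *)
From HB Require Import structures.
From mathcomp Require Import all_boot all_order all_algebra.

Set Implicit Arguments.
Unset Strict Implicit.
Unset Printing Implicit Defensive.
Import Order.TTheory GRing.Theory Num.Theory.

Definition is_setpart (n : nat) (pi : {set {set 'I_n}}) : bool :=
  partition pi [set: 'I_n].

Definition setpart (n : nat) : Type := {s : {set {set 'I_n}} | is_setpart s}.
HB.instance Definition _ n := SubFinite.on (setpart n).

Section refinement.
Variable n : nat.
Implicit Types pi sigma tau : setpart n.

Definition refines pi sigma : bool :=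
  [forall B in val pi, exists C in val sigma, B \subset C].

Lemma refinesP pi sigma :
  reflect (forall B, B \in val pi -> exists2 C, C \in val sigma & B \subset C)
          (refines pi sigma).
Proof. exact: (iffP 'forall_in_exists_inP). Qed.

Lemma refines_refl : reflexive refines.
Proof. by move=> pi; apply/refinesP => B Bpi; exists B. Qed.

Lemma refines_trans : transitive refines.
Proof.
move=> tau pi sigma /refinesP h1 /refinesP h2; apply/refinesP => B /h1[C /h2].
by case=> D Ds CD BC; exists D => //; apply: subset_trans CD.
Qed.

Lemma refines_sub pi sigma :
  refines pi sigma -> refines sigma pi -> val pi \subset val sigma.
Proof.
move=> /refinesP h1 /refinesP h2; apply/subsetP => B Bpi.
have [C Cs BC] := h1 B Bpi; have [D Dpi CD] := h2 C Cs.
have BD := subset_trans BC CD.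
have /and3P[_ triv n0] : is_setpart (val pi) := valP pi.
have eqBD : B = D.
  apply/eqP; apply: contraNT n0 => BneD.
  have /trivIsetP/(_ B D Bpi Dpi BneD) := triv.
  by rewrite -setI_eq0 (setIidPl BD) => /eqP <-.
suff -> : B = C by [].
by apply/eqP; rewrite eqEsubset BC eqBD CD.
Qed.

Lemma refines_anti : antisymmetric refines.
Proof.
move=> pi sigma /andP[h1 h2]; apply/val_inj/eqP.
by rewrite eqEsubset !refines_sub.
Qed.

Fact setpart_display : Order.disp_t. Proof. exact: Order.Disp tt tt. Qed.

HB.instance Definition _ := Order.Le_isPOrder.Build setpart_display (setpart n)
  refines_refl refines_anti refines_trans.

Lemma is_setpart_discrete : is_setpart [set [set i] | i : 'I_n].
Proof.
apply/and3P; split.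
- rewrite /cover; apply/eqP/setP => i; rewrite inE; apply/bigcupP.
  by exists [set i]; rewrite ?inE//; apply/imsetP; exists i.
- apply/trivIsetP => _ _ /imsetP[i _ ->] /imsetP[j _ ->] ij.
  by rewrite disjoints1 inE; apply: contraNN ij => /eqP ->.
- by apply/imsetP => -[i _ /setP/(_ i)]; rewrite !inE eqxx.
Qed.

Definition discrete_part : setpart n := exist (@is_setpart n) _ is_setpart_discrete.

(* Removing set0 only matters for n = 0, whose only partition is empty. *)
Lemma is_setpart_one_block : is_setpart ([set [set: 'I_n]] :\ set0).
Proof.
apply/and3P; split; last by rewrite !inE eqxx.
- rewrite /cover; apply/eqP/setP => i; rewrite inE; apply/bigcupP.
  exists setT; rewrite ?inE// eqxx andbT.
  by apply/eqP => /setP/(_ i); rewrite !inE.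
- apply/trivIsetP => A B.
  by rewrite !inE => /andP[_ /eqP->] /andP[_ /eqP->]; rewrite eqxx.
Qed.

Definition one_block_part : setpart n := exist (@is_setpart n) _ is_setpart_one_block.

Lemma discrete_part_le pi : refines discrete_part pi.
Proof.
apply/refinesP => _ /imsetP[i _ ->].
have /and3P[/eqP cov _ _] : is_setpart (val pi) := valP pi.
have : i \in cover (val pi) by rewrite cov inE.
by move=> /bigcupP[B Bpi iB]; exists B; rewrite ?sub1set.
Qed.

Lemma le_one_block_part pi : refines pi one_block_part.
Proof.
apply/refinesP => B Bpi; exists setT => //; rewrite !inE eqxx andbT.
have /and3P[_ _ n0] : is_setpart (val pi) := valP pi.
apply: contraNneq n0 => T0; suff <- : B = set0 by [].
by apply/eqP; rewrite -subset0 -T0.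
Qed.

HB.instance Definition _ :=
  Order.hasBottom.Build setpart_display (setpart n) discrete_part_le.
HB.instance Definition _ :=
  Order.hasTop.Build setpart_display (setpart n) le_one_block_part.

(* [\bot] is the partition into singletons, [\top] the one-block partition *)
Definition lower_set (T : {set setpart n}) : Prop :=
  [/\ (\bot%O : setpart n) \in T, (\top%O : setpart n) \in T &
   forall w z, w \in T :\ \top%O -> (z <= w)%O -> z \in T].

End refinement.

Lemma val_setpart_bot n : val (\bot%O : setpart n) = [set [set i] | i : 'I_n].
Proof. by []. Qed.

Lemma val_setpart_top n :
  (0 < n)%N -> val (\top%O : setpart n) = [set [set: 'I_n]].
Proof.
move=> n0; apply/setP => B; rewrite !inE andbC.
case: eqP => //= ->; apply/eqP => /setP/(_ (Ordinal n0)).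
by rewrite !inE.
Qed.

Lemma le_setpartE n (pi sigma : setpart n) : (pi <= sigma)%O = refines pi sigma.
Proof. by []. Qed.

Section moebius.
Local Open Scope ring_scope.
Context {d : Order.disp_t} {X : finPOrderType d}.
Implicit Types (T : {set X}) (x y z : X).

Fixpoint moebius_rec (k : nat) T x y : int :=
  if k is k'.+1 then
    if x == y then 1
    else if (x < y)%O then
      - \sum_(z in T | (x <= z)%O && (z < y)%O) moebius_rec k' T x z
    else 0
  else 0.

(* #|X|.+1 recursive calls suffice: see [moebiusxx], [moebius_lt] and
   [moebius_nle], which are the usual defining equations *)
Definition moebius T x y : int := moebius_rec #|X|.+1 T x y.

Let below y := #|[set z | (z < y)%O]|.

Let below_lt z y : (z < y)%O -> (below z < below y)%N.
Proof.
move=> zy; apply: proper_card; apply/properP; split.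
  by apply/subsetP => w; rewrite !inE => /lt_trans; apply.
by exists z; rewrite !inE ?zy// ltxx.
Qed.

Let moebius_rec_stable T x : forall k m y,
  (below y < k)%N -> (below y < m)%N ->
  moebius_rec k T x y = moebius_rec m T x y.
Proof.
elim=> // k IH [//|m] y; rewrite !ltnS => yk ym /=.
case: ifP => // _; case: ifP => // _; congr (- _).
apply: eq_bigr => z /andP[_ /andP[_ zy]].
by apply: IH; [apply: leq_trans yk | apply: leq_trans ym]; apply: below_lt.
Qed.

Lemma moebiusxx T x : moebius T x x = 1.
Proof. by rewrite /moebius/= eqxx. Qed.

Lemma moebius_nle T x y : ~~ (x <= y)%O -> moebius T x y = 0.
Proof.
by rewrite le_eqVlt negb_or /moebius/= => /andP[/negPf -> /negPf ->].
Qed.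

Lemma moebius_lt T x y : (x < y)%O ->
  moebius T x y = - \sum_(z in T | (x <= z)%O && (z < y)%O) moebius T x z.
Proof.
move=> xy; rewrite {1}/moebius/= xy (lt_eqF xy); congr (- _).
apply: eq_bigr => z /andP[_ /andP[_ zy]].
apply: moebius_rec_stable; last by rewrite ltnS max_card.
by apply: leq_trans (below_lt zy) _; rewrite max_card.
Qed.

End moebius.

Local Open Scope ring_scope.

Definition block_restrict (R : nmodType) (n : nat) (Sigma : 'M[R]_n)
    (pi : setpart n) : 'M[R]_n :=
  \matrix_(i, j) if j \in pblock (val pi) i then Sigma i j else 0.

From mathcomp Require Import complex.
From mathcomp Require Import all_classical all_reals all_analysis.
Import numFieldNormedType.Exports.

Local Open Scope classical_set_scope.
Local Open Scope ring_scope.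
Local Open Scope complex_scope.

(* R^n is [n.-tuple R]; its sigma-algebra, generated by the coordinates, is the
   Borel one. *)

Section gaussian.
Context {R : realType} {n : nat}.
Implicit Types (x y omega : n.-tuple R) (Sigma : 'M[R]_n).

Definition dotp x y : R := \sum_i tnth x i * tnth y i.

Definition quadf Sigma x : R :=
  \sum_i (\sum_j Sigma i j * tnth x j) * tnth x i.

Definition covariance_matrix Sigma : Prop :=
  Sigma^T = Sigma /\ forall x, 0 <= quadf Sigma x.

Definition cexp (z : R[i]) : R[i] :=
  (expR (complex.Re z) * cos (complex.Im z)) +i*
  (expR (complex.Re z) * sin (complex.Im z)).

Definition cintegral d (T : measurableType d)
    (mu : {measure set T -> \bar R}) (f : T -> R[i]) : R[i] :=
  (\int[mu]_t complex.Re (f t)) +i* (\int[mu]_t complex.Im (f t)).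

Definition fourier_transform (P : probability (n.-tuple R) R) x : R[i] :=
  cintegral P (fun xi => cexp (- ('i * (dotp x xi)%:C))).

(* [Sigma] may be degenerate, so N(omega, Sigma) need not have a density; it is
   specified by its Fourier transform. *)
Definition is_gaussian omega Sigma (P : probability (n.-tuple R) R) : Prop :=
  covariance_matrix Sigma /\
  forall x, fourier_transform P x =
    cexp (- ('i * (dotp x omega)%:C) - (quadf Sigma x / 2)%:C).

End gaussian.

Section marginals.
Context {R : realType} {n : nat}.
Implicit Types (F : {set 'I_n}) (P : probability (n.-tuple R) R).

(* R^F is encoded as [#|F|.-tuple R], coordinates being listed in the order of
   [enum F] *)
Definition coord_proj F (x : n.-tuple R) : #|F|.-tuple R :=
  [tuple tnth x (enum_val j) | j < #|F|].

Lemma measurable_coord_proj F : measurable_fun setT (coord_proj F).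
Proof.
apply/measurable_fun_tnthP => j.
rewrite (_ : _ \o _ = @tnth _ R ^~ (enum_val j)); first exact: measurable_tnth.
by apply/funext => x /=; rewrite tnth_mktuple.
Qed.

HB.instance Definition _ F :=
  isMeasurableFun.Build _ _ _ _ (coord_proj F) (@measurable_coord_proj F).

Definition marginal P F : probability (#|F|.-tuple R) R :=
  distribution P (coord_proj F).

(* The point of R^n with F-coordinates [uv.1] and the others from [uv.2] *)
Definition glue F (uv : #|F|.-tuple R * n.-tuple R) : n.-tuple R :=
  [tuple if i \in F then nth 0 uv.1 (index i (enum F)) else tnth uv.2 i | i < n].

Arguments glue F uv : clear implicits.

Lemma index_enum_val F (j : 'I_#|F|) : index (enum_val j) (enum F) = j.
Proof. by rewrite index_uniq ?enum_uniq// -cardE. Qed.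

Lemma measurable_glue F : measurable_fun setT (glue F).
Proof.
apply/measurable_fun_tnthP => i.
have [iF|iF] := boolP (i \in F).
  rewrite (_ : _ \o _ = @tnth _ R ^~ (enum_rank_in iF i) \o fst).
    by apply: measurableT_comp => //; exact: measurable_tnth.
  apply/funext => -[u v] /=; rewrite tnth_mktuple iF (tnth_nth 0)/=.
  by congr nth; rewrite -[in LHS](enum_rankK_in iF iF) index_enum_val.
rewrite (_ : _ \o _ = @tnth _ R ^~ i \o snd).
  by apply: measurableT_comp => //; exact: measurable_tnth.
by apply/funext => -[u v] /=; rewrite tnth_mktuple (negPf iF).
Qed.

HB.instance Definition _ F :=
  isMeasurableFun.Build _ _ _ _ (glue F) (@measurable_glue F).

(* P_{F_1} x (P_{F_2} x ( ... x P_{F_l})) transported to R^n; when the F_j cover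
   all the coordinates, the point carrying the Dirac mass is irrelevant *)
Fixpoint marginal_prod P (s : seq {set 'I_n}) : probability (n.-tuple R) R :=
  if s is F :: s' then
    distribution (marginal P F \x marginal_prod P s')%E (glue F)
  else \d_([tuple 0 | _ < n] : n.-tuple R).

Definition part_prod P (pi : setpart n) : probability (n.-tuple R) R :=
  marginal_prod P (enum (val pi)).

Definition lower_set_measure (T : {set setpart n}) P (A : set (n.-tuple R)) :
    \bar R :=
  (\sum_(pi in T) (moebius T pi \top%O)%:~R%:E * part_prod P pi A)%E.

Lemma measurable_rect m (D : {pred 'I_m}) (A : 'I_m -> set R) :
  (forall i, measurable (A i)) ->
  measurable [set x : m.-tuple R | forall i, i \in D -> A i (tnth x i)].
Proof.
move=> mA; rewrite [X in measurable X](_ : _ =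
  \bigcap_(i in [set i | i \in D]) (@tnth _ R ^~ i) @^-1` A i); last first.
  by apply/seteqP; split => x h i; exact: h.
apply: fin_bigcap_measurable => // i _.
by rewrite -[X in measurable X]setTI; exact: measurable_tnth.
Qed.

Lemma marginal_prod_rect P (s : seq {set 'I_n}) (A : 'I_n -> set R) :
  (forall i, measurable (A i)) -> pairwise (fun F G => [disjoint F & G]%B) s ->
  marginal_prod P s
    [set x | forall i, i \in [pred i | has (fun F : {set _} => i \in F) s] ->
       A i (tnth x i)] =
  (\prod_(F <- s) P [set x | forall i, i \in F -> A i (tnth x i)])%E.
Proof.
move=> mA; elim: s => [_|F s IH /= /andP[/allP dF ds]].
  by rewrite big_nil/= diracE mem_set.
rewrite big_cons -IH//.
set S := (X in distribution _ _ X = _).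
rewrite -[LHS]/((marginal P F \x marginal_prod P s)%E (glue F @^-1` S)).
set B := (X in (_ \x _)%E X).
pose U := [set u : #|F|.-tuple R |
  forall j, j \in predT -> A (enum_val j) (tnth u j)].
set V := (X in (_ * marginal_prod P s X)%E).
have -> : B = U `*` V.
  apply/seteqP; split => -[u v].
  - rewrite /B/S/= => h; split => /= [j _|i].
    + have := h (enum_val j); rewrite inE enum_valP => /(_ isT).
      rewrite tnth_mktuple enum_valP/= index_enum_val.
      by rewrite -tnth_nth.
    + rewrite inE => is_; have := h i; rewrite inE is_ orbT => /(_ isT).
      rewrite tnth_mktuple; case: ifPn => // iF.
      have /hasP[G Gs iG] := is_.
      by have /disjointFr/(_ iF) := dF G Gs; rewrite iG.
  - move=> [/= hU hV] i; rewrite inE tnth_mktuple/=.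
    case: ifPn => [iF _|iF /= is_]; last exact: hV.
    have := hU (enum_rank_in iF i) isT; rewrite enum_rankK_in//.
    rewrite (tnth_nth 0); congr (A i (nth 0 u _)).
    by rewrite -[in RHS](enum_rankK_in iF iF) index_enum_val.
rewrite product_measure1E; first last.
- exact: measurable_rect.
- by apply: (@measurable_rect _ predT (fun j => A (enum_val j))) => j; exact: mA.
congr (_ * _)%E.
rewrite -[LHS]/(P (coord_proj F @^-1` U)); congr (P _).
apply/seteqP; split => x /= h.
  move=> i iF; have := h (enum_rank_in iF i) isT.
  by rewrite tnth_mktuple enum_rankK_in.
by move=> j _; rewrite tnth_mktuple; apply: h; exact: enum_valP.
Qed.

Lemma part_prod_rect P (pi : setpart n) (A : 'I_n -> set R) :
  (forall i, measurable (A i)) ->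
  part_prod P pi [set x | forall i, A i (tnth x i)] =
  (\prod_(F in val pi) P [set x | forall i, i \in F -> A i (tnth x i)])%E.
Proof.
move=> mA; have /and3P[/eqP cov /finset.trivIsetP triv _] : is_setpart (val pi) := valP pi.
rewrite -big_enum/= -marginal_prod_rect//.
  rewrite /part_prod; congr (marginal_prod _ _ _).
  apply/seteqP; split => x /= h i; first by move=> _; exact: h.
  apply: h; rewrite inE; apply/hasP.
  have : i \in finset.cover (val pi) by rewrite cov inE.
  by move=> /finset.bigcupP[F Fpi iF]; exists F; rewrite ?mem_enum.
have : uniq (enum (val pi)) by exact: enum_uniq.
rewrite uniq_pairwise.
apply: (@sub_in_pairwise _ (mem (val pi))); first by move=> F G /=; exact: triv.
by apply/allP => F; rewrite mem_enum.
Qed.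

End marginals.

(* Main.v *)
Require Import Defs.
From mathcomp Require Import all_boot all_order all_algebra.
From mathcomp Require Import complex ring lra.
From mathcomp Require Import all_classical all_reals all_analysis.
From mathcomp Require Import measurable_realfun.

Set Implicit Arguments.
Unset Strict Implicit.
Unset Printing Implicit Defensive.
Import Order.TTheory GRing.Theory Num.Theory.
Import numFieldNormedType.Exports.

Local Open Scope classical_set_scope.
Local Open Scope ring_scope.

(** Every product of marginals of a Gaussian measure is again Gaussian: the
Fourier transform of a product of marginals is the product of the Fourier
transforms at the restrictions of the argument to the blocks
([fourier_part_prod]), and for N(omega, Sigma) this multiplies out to the
transform of N(omega, Sigma_pi) ([trig_part_prod]).  So everything is governed
by the matrices Sigma_pi.

If Sigma = Sigma_pi with pi in T below the top, then for every sigma in T the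
matrices Sigma_sigma and Sigma_(sigma /\ pi) coincide, hence so do N_sigma and
N_(sigma /\ pi), because a probability measure on R^n is determined by its
Fourier transform ([trig_uniqueness]).  Thus T[N] is the sum of
mu(sigma, 1) N_(sigma /\ pi), and a sum of this kind always vanishes, by an
argument of Weisner type: expand N_(sigma /\ pi) by Moebius inversion as a sum
over the elements of T below both sigma and pi, and exchange the sums; for
c <= pi < 1 the numbers mu(sigma, 1) with sigma >= c add up to zero
([sum_moebius_meet]).

If conversely T[N] = 0, integrating the characters exp(-i<x, xi>) against it and
dividing by the common factor exp(-i<x, omega>) gives, for every x, the relation
  sum over pi in T of mu(pi, 1) exp(- <Sigma_pi x, x> / 2) = 0.
Were Sigma different from all Sigma_pi with pi in T below the top, one could
choose x so that <Sigma x, x> differs from all these <Sigma_pi x, x> at once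
([exists_generic_vec]).  Replacing x by sqrt k x turns each exponential into its
k-th power, so a combination of k-th powers of numbers r_pi vanishes for all k,
where r_1 differs from the other r_pi.  This forces the coefficient of r_1 to be
zero ([power_sums_eq0]), yet mu(1, 1) = 1.

Uniqueness of the Fourier transform is obtained here from a multiplicative
system argument.  The functions f such that multiplication by f preserves
equality of the Fourier transforms of h dP and h dQ form an algebra that is closed
under bounded pointwise limits and contains the characters.  Iterating a cubic
polynomial gives the sign function on [-1, 1] as such a limit
([iter_smoothstep_cvg]); applied to sin ((xi_i - a) / L) with L tending to
infinity it yields the indicators of half-spaces, and from there those of all
Borel sets. *)

(** * Moebius inversion on a subset of a finite poset *)
Section moebius_inversion.
Context {d : Order.disp_t} {X : finPOrderType d}.
Implicit Types (T : {set X}) (a x y z : X).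

Lemma sum_moebiusl T x y : y \in T ->
  \sum_(z in T | (x <= z <= y)%O) moebius T x z = (x == y)%:R.
Proof.
have [<- xT|xy yT] := eqVneq x y.
  rewrite (big_pred1 x) ?moebiusxx// => z /=.
  by rewrite -eq_le eq_sym andb_idl// => /eqP ->.
have [ltxy|nlexy] := boolP (x < y)%O.
  rewrite (bigD1 y) /=; last by rewrite yT (ltW ltxy) lexx.
  rewrite (moebius_lt _ ltxy) addrC; apply/eqP; rewrite subr_eq0; apply/eqP.
  by apply: eq_bigl => z; rewrite lt_neqAle -!andbA; do !bool_congr.
rewrite big1// => z /andP[_ /andP[xz zy]].
by move: nlexy; rewrite lt_neqAle xy (le_trans xz zy).
Qed.

(** The defining recursion of mu is the identity [sum_moebiusl], which says that
the matrix of mu is a left inverse of the zeta matrix of [T]; for square matrices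
over a commutative ring it is then a right inverse as well. *)
Lemma sum_moebiusr T x y : x \in T -> y \in T ->
  \sum_(z in T | (x <= z <= y)%O) moebius T z y = (x == y)%:R.
Proof.
move=> xT yT.
pose M := \matrix_(i < #|T|, j < #|T|) moebius T (enum_val i) (enum_val j).
pose Z := \matrix_(i < #|T|, j < #|T|) ((enum_val i <= enum_val j)%O%:R : int).
have MZ : M *m Z = 1%:M.
  apply/matrixP => i j; rewrite !mxE.
  rewrite -(inj_eq enum_val_inj) -(sum_moebiusl _ (enum_valP j)).
  rewrite big_enum_val_cond/=.
  rewrite [RHS]big_mkcond; apply: eq_bigr => k _; rewrite !mxE.
  case: (boolP (enum_val k <= _)%O) => _; last by rewrite mulr0 andbF.
  by rewrite mulr1 andbT; case: ifPn => // /moebius_nle ->.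
have /matrixP/(_ (enum_rank_in xT x) (enum_rank_in yT y)) := mulmx1C MZ.
rewrite !mxE -(inj_eq enum_val_inj) !enum_rankK_in// => <-.
rewrite big_enum_val_cond/= big_mkcond; apply: eq_bigr => k _.
rewrite !mxE !enum_rankK_in//.
case: (boolP (x <= _)%O) => _; last by rewrite mul0r.
by rewrite mul1r; case: ifPn => //= /moebius_nle ->.
Qed.

(** The function [m] is the meet with [a], given through its lower bounds in [T].
With [k] the Moebius inverse of [g], the sum becomes that of the [k c] with
[c <= a], each weighted by the sum of [moebius T s y] over the [s] between [c]
and [y], which vanishes as [c <= a < y]. *)
Lemma sum_moebius_meet (K : comPzRingType) T y a (m : X -> X) (g : X -> K) :
  y \in T -> (forall z, z \in T -> (z <= y)%O) ->
  a \in T -> a != y ->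
  (forall s, s \in T -> m s \in T) ->
  (forall c s, c \in T -> s \in T ->
     (c <= m s)%O = (c <= s)%O && (c <= a)%O) ->
  \sum_(s in T) (moebius T s y)%:~R * g (m s) = 0.
Proof.
move=> yT topy aT ay mT mE.
pose k c := \sum_(b in T | (b <= c)%O) (moebius T b c)%:~R * g b.
have gE t : t \in T -> g t = \sum_(c in T | (c <= t)%O) k c.
  move=> tT; rewrite /k (exchange_big_dep (mem T))/=; last first.
    by move=> c b _ /andP[].
  rewrite (bigD1 t tT)/= [X in _ + X]big1 ?addr0.
    by rewrite (big_pred1 t) ?moebiusxx ?mul1r// => c /=;
      rewrite tT /= -andbA -eq_le andb_idl// => /eqP ->.
  move=> b /andP[Tb bt]; have bT : b \in T by []; rewrite -mulr_suml.
  rewrite -(rmorph_sum (intmul 1)) /=.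
  rewrite (eq_bigl (fun c => (c \in T) && (b <= c <= t)%O)).
    by rewrite sum_moebiusl// (negPf bt) mul0r.
  by move=> c; rewrite bT /= -andbA; congr (_ && _); rewrite andbC.
transitivity (\sum_(s in T) \sum_(c in T | (c <= m s)%O)
    (moebius T s y)%:~R * k c).
  by apply: eq_bigr => s sT; rewrite gE ?mT// mulr_sumr.
(* The c below m s are those below both s and a, so a bounds the outer sum. *)
rewrite (exchange_big_dep (fun c => (c \in T) && (c <= a)%O))/=; last first.
  by move=> s c sT /andP[cT]; rewrite mE// cT => /andP[].
rewrite big1// => c /andP[cT ca]; rewrite -mulr_suml -(rmorph_sum (intmul 1)) /=.
rewrite (eq_bigl (fun s => (s \in T) && (c <= s <= y)%O)); last first.
  move=> s; case: (boolP (s \in T)) => //= sT.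
  by rewrite cT mE// ca andbT topy// andbT.
rewrite sum_moebiusr// (_ : (c == y) = false) ?mul0r//.
apply: contra_neqF ay => /eqP cy; apply/eqP; rewrite eq_le -{2}cy ca andbT.
exact: topy.
Qed.

End moebius_inversion.

(** * Common refinements of set partitions *)

Section setpart_meet.
Context {n : nat}.
Implicit Types (pi sigma tau : setpart n) (i j : 'I_n) (B F G : {set 'I_n}).

Lemma setpart_trivIset pi : finset.trivIset (val pi).
Proof. by have /and3P[] : is_setpart (val pi) := valP pi. Qed.

Lemma setpart_set0 pi : finset.set0 \notin val pi.
Proof. by have /and3P[] : is_setpart (val pi) := valP pi. Qed.

Lemma mem_setpart_block pi i : i \in finset.pblock (val pi) i.
Proof.
have /and3P[/eqP cov _ _] : is_setpart (val pi) := valP pi.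
by rewrite finset.mem_pblock cov inE.
Qed.

Lemma setpart_block pi i : finset.pblock (val pi) i \in val pi.
Proof.
by apply: finset.pblock_mem; rewrite -finset.mem_pblock mem_setpart_block.
Qed.

Lemma setpart_blockE pi F i : F \in val pi -> i \in F ->
  finset.pblock (val pi) i = F.
Proof. by move=> Fpi; apply: finset.def_pblock => //; exact: setpart_trivIset. Qed.

Definition meet_blocks pi sigma : {set {set 'I_n}} :=
  ([set F :&: G | F in val pi, G in val sigma] :\ finset.set0)%SET.

Lemma meet_blocksP pi sigma B : reflect
  (exists i, B = (finset.pblock (val pi) i :&: finset.pblock (val sigma) i)%SET)
  (B \in meet_blocks pi sigma).
Proof.
apply: (iffP idP) => [|[i ->]]; rewrite !inE.
  move=> /andP[/finset.set0Pn[i iB] /imset2P[F G Fpi Gs BE]].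
  exists i; move: iB; rewrite BE inE => /andP[iF iG].
  by rewrite (setpart_blockE Fpi iF) (setpart_blockE Gs iG).
apply/andP; split; last by apply/imset2P; exists (finset.pblock (val pi) i)
  (finset.pblock (val sigma) i); rewrite ?setpart_block.
by apply/finset.set0Pn; exists i; rewrite inE !mem_setpart_block.
Qed.

Lemma is_setpart_meet pi sigma : is_setpart (meet_blocks pi sigma).
Proof.
apply/and3P; split.
- apply/eqP/finset.setP => i; rewrite inE; apply/finset.bigcupP.
  exists (finset.pblock (val pi) i :&: finset.pblock (val sigma) i)%SET.
    by apply/meet_blocksP; exists i.
  by rewrite inE !mem_setpart_block.
- apply/finset.trivIsetP => _ _ /meet_blocksP[i ->] /meet_blocksP[j ->].
  apply: contraNT => /pred0Pn[k] /=; rewrite !inE.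
  move=> /andP[/andP[ki ki'] /andP[kj kj']].
  rewrite -(finset.same_pblock (setpart_trivIset pi) ki).
  rewrite -(finset.same_pblock (setpart_trivIset sigma) ki').
  rewrite -(finset.same_pblock (setpart_trivIset pi) kj).
  by rewrite -(finset.same_pblock (setpart_trivIset sigma) kj').
- by rewrite !inE eqxx.
Qed.

Definition setpart_meet pi sigma : setpart n :=
  exist (@is_setpart n) _ (is_setpart_meet pi sigma).

Lemma mem_pblock_meet pi sigma i j :
  (j \in finset.pblock (val (setpart_meet pi sigma)) i) =
  (j \in finset.pblock (val pi) i) && (j \in finset.pblock (val sigma) i).
Proof.
rewrite (@setpart_blockE _
  (finset.pblock (val pi) i :&: finset.pblock (val sigma) i)%SET).
- by rewrite inE.
- by apply/meet_blocksP; exists i.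
- by rewrite inE !mem_setpart_block.
Qed.

Lemma le_setpartP pi sigma : reflect
  (forall i j, j \in finset.pblock (val pi) i ->
     j \in finset.pblock (val sigma) i)
  (pi <= sigma)%O.
Proof.
rewrite le_setpartE; apply: (iffP (refinesP _ _)) => [h i j ji|h B Bpi].
  have [C Cs /fintype.subsetP BC] := h _ (setpart_block pi i).
  by rewrite (setpart_blockE Cs (BC _ (mem_setpart_block pi i))) BC.
have /finset.set0Pn[i iB] : B != finset.set0.
  by apply: contraNneq (setpart_set0 pi) => <-.
exists (finset.pblock (val sigma) i); first exact: setpart_block.
by apply/fintype.subsetP => j; rewrite -(setpart_blockE Bpi iB); exact: h.
Qed.

Lemma le_setpart_meet tau pi sigma :
  (tau <= setpart_meet pi sigma)%O = (tau <= pi)%O && (tau <= sigma)%O.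
Proof.
apply/le_setpartP/andP => [h|[/le_setpartP h1 /le_setpartP h2] i j ij].
  by split; apply/le_setpartP => i j /h; rewrite mem_pblock_meet => /andP[].
by rewrite mem_pblock_meet h1 ?h2.
Qed.

(** This is why the value of a product of marginals at sigma depends only on the
meet with pi as soon as Sigma = Sigma_pi. *)
Lemma block_restrict_meet (K : nmodType) (S : 'M[K]_n) pi sigma :
  block_restrict (block_restrict S sigma) pi =
  block_restrict S (setpart_meet pi sigma).
Proof.
apply/matrixP => i j; rewrite !mxE mem_pblock_meet.
by case: (j \in finset.pblock (val pi) i).
Qed.

Lemma block_restrict_tr (K : nmodType) (S : 'M[K]_n) pi :
  (block_restrict S pi)^T = block_restrict S^T pi.
Proof.
apply/matrixP => i j; rewrite !mxE.
suff -> : (i \in finset.pblock (val pi) j) = (j \in finset.pblock (val pi) i) by [].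
by apply/idP/idP => /(finset.same_pblock (setpart_trivIset pi)) ->;
  exact: mem_setpart_block.
Qed.

Lemma block_restrict_top (K : nmodType) (S : 'M[K]_n) :
  block_restrict S \top%O = S.
Proof.
apply/matrixP => i j; rewrite mxE ifT//.
have := setpart_block \top%O i.
rewrite val_setpart_top ?(leq_ltn_trans _ (ltn_ord i))//.
by move=> /finset.set1P ->; rewrite inE.
Qed.

End setpart_meet.

(** * Bounded measurable functions and their expectations *)

Section bounded_functions.
Context d (T : measurableType d) {R : realType}.
Implicit Types (f g : T -> R) (P : probability T R).

Definition bounded_mfun f :=
  measurable_fun setT f /\ exists M, forall t, `|f t| <= M.

Lemma bounded_mfun_cst (c : R) : bounded_mfun (fun=> c).
Proof. by split; [exact: measurable_cst|exists `|c|]. Qed.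

Lemma bounded_mfunD f g : bounded_mfun f -> bounded_mfun g ->
  bounded_mfun (fun t => f t + g t).
Proof.
move=> [mf [M fM]] [mg [K gK]]; split; first exact: measurable_funD.
by exists (M + K) => t; rewrite (le_trans (ler_normD _ _))// lerD.
Qed.

Lemma bounded_mfunM f g : bounded_mfun f -> bounded_mfun g ->
  bounded_mfun (fun t => f t * g t).
Proof.
move=> [mf [M fM]] [mg [K gK]]; split; first exact: measurable_funM.
by exists (M * K) => t; rewrite normrM ler_pM.
Qed.

Lemma bounded_mfun_cos f : measurable_fun setT f ->
  bounded_mfun (fun t => cos (f t)).
Proof.
move=> mf; split; last first.
  by exists 1 => t; rewrite ler_norml cos_geN1 cos_le1.
apply: measurableT_comp mf.
by apply: continuous_measurable_fun; exact: continuous_cos.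
Qed.

Lemma bounded_mfun_sin f : measurable_fun setT f ->
  bounded_mfun (fun t => sin (f t)).
Proof.
move=> mf; split; last first.
  by exists 1 => t; rewrite ler_norml sin_geN1 sin_le1.
apply: measurableT_comp mf.
by apply: continuous_measurable_fun; exact: continuous_sin.
Qed.

Lemma bounded_mfun_integrable P f : bounded_mfun f ->
  P.-integrable setT (EFin \o f).
Proof.
move=> [mf [M fM]]; apply: measurable_bounded_integrable => //.
  exact: fin_num_fun_lty.
exists M; split; first exact: num_real.
by move=> x Mx t _ /=; rewrite (le_trans (fM t))// ltW.
Qed.

Lemma expectD P f g : bounded_mfun f -> bounded_mfun g ->
  \int[P]_t (f t + g t) = \int[P]_t f t + \int[P]_t g t.
Proof.
by move=> bf bg; apply: RintegralD => //; exact: bounded_mfun_integrable.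
Qed.

Lemma expectB P f g : bounded_mfun f -> bounded_mfun g ->
  \int[P]_t (f t - g t) = \int[P]_t f t - \int[P]_t g t.
Proof.
by move=> bf bg; apply: RintegralB => //; exact: bounded_mfun_integrable.
Qed.

Lemma expectZ P (c : R) f : bounded_mfun f ->
  \int[P]_t (c * f t) = c * \int[P]_t f t.
Proof.
by move=> bf; apply: RintegralZl => //; exact: bounded_mfun_integrable.
Qed.

(** Bounded pointwise convergence, the mode of convergence under which
expectations are continuous and which is stable under bounded factors. *)
Definition bounded_cvg (f_ : nat -> T -> R) f :=
  (exists M, forall k t, `|f_ k t| <= M) /\
  forall t, (fun k => f_ k t) @ \oo --> f t.

Lemma bounded_cvg_mfun (f_ : nat -> T -> R) f :
  (forall k, measurable_fun setT (f_ k)) ->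
  bounded_cvg f_ f -> bounded_mfun f.
Proof.
move=> mf_ [[M fM] f_f]; split.
  by apply: (@measurable_fun_cvg _ _ _ _ f_) => // t _; exact: f_f.
exists M => t.
have : (fun k => `|f_ k t|) @ \oo --> `|f t| by apply: cvg_norm; exact: f_f.
move=> /cvgr_to_le; apply.
by apply: nearW => k; exact: fM.
Qed.

Lemma bounded_cvgM (f_ : nat -> T -> R) f g :
  bounded_cvg f_ f -> bounded_mfun g ->
  bounded_cvg (fun k t => f_ k t * g t) (fun t => f t * g t).
Proof.
move=> [[M fM] f_f] [_ [K gK]]; split.
  by exists (M * K) => k t; rewrite normrM ler_pM.
by move=> t; apply: cvgMl; exact: f_f.
Qed.

Lemma expect_cvg P (f_ : nat -> T -> R) f :
  (forall k, measurable_fun setT (f_ k)) ->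
  bounded_cvg f_ f -> (fun k => \int[P]_t f_ k t) @ \oo --> \int[P]_t f t.
Proof.
move=> mf_ /[dup] /(bounded_cvg_mfun mf_) bf [[M fM] f_f].
have [|||||_ _ cvgf] := @dominated_convergence _ _ _ P setT measurableT
  (fun k => EFin \o f_ k) (EFin \o f) (EFin \o cst M).
- by move=> k; exact/measurable_EFinP.
- by case: bf => mf _; exact/measurable_EFinP.
- apply: aeW => t _ /=; apply: cvg_EFin; first exact: nearW.
  exact: f_f.
- by apply: bounded_mfun_integrable; exact: bounded_mfun_cst.
- by apply: aeW => t k _ /=; rewrite lee_fin.
apply: fine_cvg; rewrite fineK//.
by apply: integrable_fin_num => //; exact: bounded_mfun_integrable.
Qed.

End bounded_functions.

Lemma bounded_mfun_comp {R : realType} d1 d2 (T1 : measurableType d1)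
    (T2 : measurableType d2) (f : T2 -> R) (phi : T1 -> T2) :
  measurable_fun setT phi ->
  bounded_mfun f -> bounded_mfun (fun t => f (phi t)).
Proof.
by move=> mphi [mf [M fM]]; split; [exact: measurableT_comp|exists M].
Qed.

(** * Linear and quadratic forms on R^n *)

Section vectors.
Context {R : realType} {n : nat}.
Implicit Types (x y z : n.-tuple R).

Lemma measurable_dotp x : measurable_fun setT (dotp x).
Proof.
apply: measurable_sum => i; apply: measurable_funM => //.
exact: measurable_tnth.
Qed.

Definition tuple_comb (a b : R) x y : n.-tuple R :=
  [tuple a * tnth x i + b * tnth y i | i < n].

Lemma dotp_comb a b x y z :
  dotp (tuple_comb a b x y) z = a * dotp x z + b * dotp y z.
Proof.
rewrite /dotp !mulr_sumr -big_split/=; apply: eq_bigr => i _.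
by rewrite tnth_mktuple; ring.
Qed.

Definition coord_vec (i : 'I_n) (c : R) : n.-tuple R :=
  [tuple if j == i then c else 0 | j < n].

Lemma dotp_coord_vec i c y : dotp (coord_vec i c) y = c * tnth y i.
Proof.
rewrite /dotp (bigD1 i)//= tnth_mktuple eqxx big1 ?addr0// => j ji.
by rewrite tnth_mktuple (negPf ji) mul0r.
Qed.

Definition restrict_tuple (F : {set 'I_n}) (x : n.-tuple R) : n.-tuple R :=
  [tuple if i \in F then tnth x i else 0 | i < n].

Lemma dotp_restrict (F : {set 'I_n}) x y :
  dotp (restrict_tuple F x) y = \sum_(i in F) tnth x i * tnth y i.
Proof.
rewrite [RHS]big_mkcond; apply: eq_bigr => i _; rewrite tnth_mktuple.
by case: ifP; rewrite ?mul0r.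
Qed.

End vectors.

Section quadratic_forms.
Context {R : realType} {n : nat}.
Implicit Types (x y z : n.-tuple R) (D : 'M[R]_n).

Definition bilf D x y : R := \sum_i (\sum_j D i j * tnth x j) * tnth y i.

Lemma bilf_combl D a b x y z :
  bilf D (tuple_comb a b x y) z = a * bilf D x z + b * bilf D y z.
Proof.
rewrite /bilf !mulr_sumr -big_split/=; apply: eq_bigr => i _.
rewrite !mulrA -mulrDl; congr (_ * _).
rewrite !mulr_sumr -big_split/=; apply: eq_bigr => j _.
by rewrite tnth_mktuple; ring.
Qed.

Lemma bilf_combr D a b x y z :
  bilf D z (tuple_comb a b x y) = a * bilf D z x + b * bilf D z y.
Proof.
rewrite /bilf !mulr_sumr -big_split/=; apply: eq_bigr => i _.
by rewrite tnth_mktuple; ring.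
Qed.

Lemma quadf_comb D a b x y : quadf D (tuple_comb a b x y) =
  a ^+ 2 * quadf D x + a * b * (bilf D x y + bilf D y x) + b ^+ 2 * quadf D y.
Proof.
rewrite -[LHS]/(bilf _ _ _) -[quadf D x]/(bilf _ _ _) -[quadf D y]/(bilf _ _ _).
by rewrite bilf_combl !bilf_combr; ring.
Qed.

Lemma bilf_coord_vec D (i j : 'I_n) :
  bilf D (coord_vec j 1) (coord_vec i 1) = D i j.
Proof.
rewrite /bilf (bigD1 i)//= [X in _ + X]big1 ?addr0 => [|k ki]; last first.
  by rewrite tnth_mktuple (negPf ki) mulr0.
rewrite tnth_mktuple eqxx mulr1 (bigD1 j)//= big1 ?addr0 => [|k kj].
  by rewrite tnth_mktuple eqxx mulr1.
by rewrite tnth_mktuple (negPf kj) mulr0.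
Qed.

(** Polarisation: the value at [e_i + e_j] isolates twice the entry [D i j]. *)
Lemma quadf_eq0 D : D^T = D -> (forall x, quadf D x = 0) -> D = 0.
Proof.
move=> DT q0; apply/matrixP => i j; rewrite mxE.
have := q0 (tuple_comb 1 1 (coord_vec j 1) (coord_vec i 1)).
rewrite quadf_comb !q0 !bilf_coord_vec.
have -> : D j i = D i j by rewrite -{1}DT mxE.
lra.
Qed.

Lemma exists_nonroot (p : {poly R}) : p != 0 -> exists t, p.[t] != 0.
Proof.
move=> p0; apply/not_existsP => pr.
have pr0 t : root p t by apply/negPn/negP; exact: pr.
pose s : seq R := [seq k%:R | k <- iota 0 (size p)].
have : (size s < size p)%N.
  apply: max_poly_roots => //; first by apply/allP => t _; exact: pr0.
  by rewrite map_inj_uniq ?iota_uniq// => i j /eqP; rewrite eqr_nat => /eqP.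
by rewrite size_map size_iota ltnn.
Qed.

(** Induction on the list: if [x] works for the tail and [y] for the head, each
form along the line [x + t y] is a polynomial in [t], nonzero by its value at 0
(tail) or its coefficient of degree 2 (head).  The product of these polynomials
has only finitely many roots. *)
Lemma exists_generic_vec (Ds : seq 'M[R]_n) :
  (forall D, D \in Ds -> D^T = D /\ D != 0) ->
  exists x, forall D, D \in Ds -> quadf D x != 0.
Proof.
elim: Ds => [_|D Ds IH symD]; first by exists [tuple 0 | i < n].
have [|x xDs] := IH; first by move=> E EDs; apply: symD; rewrite inE EDs orbT.
have [y yD] : exists y, quadf D y != 0.
  apply/not_existsP => q0; have [DT /eqP] := symD D (mem_head _ _).
  by apply; apply: quadf_eq0 => // y; apply/eqP/negPn/negP; exact: q0.
pose p (E : 'M[R]_n) : {poly R} := (quadf E x)%:P +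
  (bilf E x y + bilf E y x) *: 'X + quadf E y *: 'X^2.
have pE E t : (p E).[t] = quadf E (tuple_comb 1 t x y).
  rewrite quadf_comb /p !hornerD hornerC !hornerZ hornerX hornerXn.
  by rewrite expr1n; ring.
have [t] : exists t, (\prod_(E <- D :: Ds) p E).[t] != 0.
  apply: exists_nonroot; rewrite prodf_seq_neq0; apply/allP => E /=.
  rewrite inE => /predU1P[->|EDs].
    apply: contraNneq yD => /(congr1 (fun q : {poly R} => q`_2)).
    by rewrite !coefD !coefZ coefC coefX coefXn coef0/= mulr0 mulr1 !add0r => ->.
  apply: contraNneq (xDs _ EDs) => /(congr1 (fun q : {poly R} => q.[0])).
  rewrite horner0 /p !hornerD hornerC !hornerZ hornerX hornerXn expr0n/=.
  by rewrite !mulr0 !addr0 => ->.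
rewrite horner_prod prodf_seq_neq0 => /allP nz.
by exists (tuple_comb 1 t x y) => E EDs; rewrite -pE; exact: nz.
Qed.

Lemma quadfB D1 D2 x : quadf (D1 - D2) x = quadf D1 x - quadf D2 x.
Proof.
rewrite /quadf -sumrB; apply: eq_bigr => i _.
rewrite -mulrBl -sumrB; congr (_ * _); apply: eq_bigr => j _.
by rewrite !mxE mulrBl.
Qed.

Lemma sum_over_blocks (V : nmodType) (pi : setpart n) (f : 'I_n -> V) :
  \sum_(F in val pi) \sum_(i in F) f i = \sum_i f i.
Proof.
rewrite -(finset.set_partition_big _ (valP pi)).
by apply: eq_bigl => i; rewrite inE.
Qed.

Lemma sum_quadf_restrict D (pi : setpart n) x :
  \sum_(F in val pi) quadf D (restrict_tuple F x) =
  quadf (block_restrict D pi) x.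
Proof.
rewrite /quadf -(sum_over_blocks pi).
apply: eq_bigr => F Fpi; rewrite [RHS]big_mkcond; apply: eq_bigr => i _.
rewrite tnth_mktuple; case: ifPn => iF; last by rewrite mulr0.
congr (_ * _); apply: eq_bigr => j _.
rewrite tnth_mktuple mxE (setpart_blockE Fpi iF).
by case: ifP; rewrite ?mulr0 ?mul0r.
Qed.

Lemma sum_dotp_restrict (pi : setpart n) x y :
  \sum_(F in val pi) dotp (restrict_tuple F x) y = dotp x y.
Proof.
rewrite [RHS]/dotp -(sum_over_blocks pi).
by apply: eq_bigr => F Fpi; exact: dotp_restrict.
Qed.

End quadratic_forms.

(** * Uniqueness of Fourier transforms *)

Section smoothstep.
Context {R : realType}.

(** An odd cubic mapping [-1, 1] to itself, with attracting fixed points -1 and 1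
and repelling fixed point 0; its iterates are polynomials that converge to the
sign function on [-1, 1]. *)
Definition smoothstep (s : R) : R := (3 * s - s ^+ 3) / 2.

Lemma smoothstep_odd s : smoothstep (- s) = - smoothstep s.
Proof. by rewrite /smoothstep; ring. Qed.

Lemma iter_smoothstep_odd k s :
  iter k smoothstep (- s) = - iter k smoothstep s.
Proof. by elim: k => //= k ->; rewrite smoothstep_odd. Qed.

(** One step from u >= s multiplies the distance to 1 by (1 - u) (2 + u) / 2,
which is at most 1 - s / 2; hence a geometric rate when s > 0. *)
Lemma iter_smoothstep_bounds k s : 0 <= s -> s <= 1 ->
  [/\ s <= iter k smoothstep s, iter k smoothstep s <= 1 &
   1 - (1 - s / 2) ^+ k <= iter k smoothstep s].
Proof.
move=> s0 s1; elim: k => [|k [IH0 IH1 IH2]].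
  by rewrite expr0 subrr; split.
rewrite iterS; set u := iter k smoothstep s in IH0 IH1 IH2 *.
(* The error 1 - u has a double zero at the fixed point 1. *)
have eqs : 1 - smoothstep u = (1 - u) * ((1 - u) * (2 + u) / 2).
  by rewrite /smoothstep; field.
have eqd : smoothstep u - u = u * (1 - u) * (1 + u) / 2.
  by rewrite /smoothstep; field.
have d0 : 0 <= u * (1 - u) * (1 + u).
  by rewrite !mulr_ge0 //; lra.
have e0 : 0 <= (1 - u) * (1 - u) * (2 + u).
  by rewrite !mulr_ge0 //; lra.
have fac : (1 - u) * (2 + u) / 2 <= 1 - s / 2.
  have : 0 <= u * u by rewrite mulr_ge0 //; lra.
  lra.
have fac0 : 0 <= (1 - u) * (2 + u) / 2.
  by rewrite !mulr_ge0 //; lra.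
split; [lra|lra|].
rewrite exprSr.
have : (1 - u) * ((1 - u) * (2 + u) / 2) <= (1 - s / 2) ^+ k * (1 - s / 2).
  by rewrite ler_pM //; lra.
lra.
Qed.

Lemma iter_smoothstep_cvg s : `|s| <= 1 ->
  (fun k => iter k smoothstep s) @ \oo --> Num.sg s.
Proof.
have pos r : 0 < r -> r <= 1 -> (fun k => iter k smoothstep r) @ \oo --> (1 : R).
  move=> r0 r1; apply: (@squeeze_cvgr _ _ _ _ (fun k => 1 - (1 - r / 2) ^+ k) (cst 1)).
  - by apply: nearW => k; have [||_ ? ?] := @iter_smoothstep_bounds k r;
      [lra|lra|exact/andP].
  - rewrite -[X in _ --> X]subr0; apply: cvgB; first exact: cvg_cst.
    have := @cvg_geometric R 1 (1 - r / 2).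
    rewrite ger0_norm; last by lra.
    move=> /(_ _); rewrite (_ : geometric _ _ = (fun k => (1 - r / 2) ^+ k)); last first.
      by apply/funext => k /=; rewrite mul1r.
    by apply; lra.
  - exact: cvg_cst.
rewrite ler_norml => /andP[sN1 s1]; case: (ltgtP s 0) => [s0|s0|->].
- rewrite ltr0_sg// (_ : (fun k => _) = (fun k => - iter k smoothstep (- s))).
    by apply: cvgN; apply: pos; lra.
  by apply/funext => k; rewrite iter_smoothstep_odd opprK.
- by rewrite gtr0_sg//; apply: pos; lra.
- rewrite sgr0 (_ : (fun k => _) = cst 0); first exact: cvg_cst.
  apply/funext => k /=; elim: k => //= k ->.
  by rewrite /smoothstep; ring.
Qed.

Lemma iter_smoothstep_norm k s : `|s| <= 1 -> `|iter k smoothstep s| <= 1.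
Proof.
rewrite !ler_norml => /andP[sN1 s1]; have [s0|s0] := leP 0 s.
  by have [||? ? _] := @iter_smoothstep_bounds k s;
    rewrite //; apply/andP; split; lra.
have [||] := @iter_smoothstep_bounds k (- s); [lra|lra|].
by rewrite iter_smoothstep_odd => ? ? _; apply/andP; split; lra.
Qed.

End smoothstep.

Lemma sgr_sin {R : realType} (u : R) : `|u| < 1 -> Num.sg (sin u) = Num.sg u.
Proof.
have sin_pos (v : R) : 0 < v -> v < 1 -> 0 < sin v.
  move=> v0 v1; apply: sin_gt0_pi; rewrite v0 (lt_le_trans v1)//.
  by apply: le_trans (pi_ge2 R); rewrite ler1n.
rewrite ltr_norml => /andP[uN1 u1]; have [u0|u0|->] := ltgtP u 0.
- rewrite (ltr0_sg u0) ltr0_sg// -oppr_gt0 -sinN.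
  by apply: sin_pos; rewrite ?oppr_gt0// ltrNl.
- by rewrite !gtr0_sg// sin_pos.
- by rewrite sin0.
Qed.

Section fourier_uniqueness.
Context {R : realType} {n : nat}.
Variables P Q : probability (n.-tuple R) R.
Implicit Types (x : n.-tuple R) (f g h : n.-tuple R -> R).

Hypothesis eq_cos : forall x,
  \int[P]_y cos (dotp x y) = \int[Q]_y cos (dotp x y).
Hypothesis eq_sin : forall x,
  \int[P]_y sin (dotp x y) = \int[Q]_y sin (dotp x y).

(** The signed measures [h dP] and [h dQ] have the same Fourier transform. *)
Definition same_fourier h := bounded_mfun h /\ forall x,
  \int[P]_y (h y * cos (dotp x y)) = \int[Q]_y (h y * cos (dotp x y)) /\
  \int[P]_y (h y * sin (dotp x y)) = \int[Q]_y (h y * sin (dotp x y)).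

(** Unlike [same_fourier], this condition is stable under products. *)
Definition multiplier f := bounded_mfun f /\
  forall h, same_fourier h -> same_fourier (fun y => f y * h y).

Lemma same_fourier1 : same_fourier (fun=> 1).
Proof.
split; first exact: bounded_mfun_cst.
by move=> x; split; under eq_Rintegral do rewrite mul1r;
  under [in RHS]eq_Rintegral do rewrite mul1r.
Qed.

Lemma same_fourierZ c h : same_fourier h -> same_fourier (fun y => c * h y).
Proof.
move=> [bh Eh]; split; first by apply: bounded_mfunM => //; exact: bounded_mfun_cst.
move=> x; have [Ec Es] := Eh x.
have bc := bounded_mfunM bh (bounded_mfun_cos (measurable_dotp x)).
have bs := bounded_mfunM bh (bounded_mfun_sin (measurable_dotp x)).
split.
- under eq_Rintegral do rewrite -mulrA.
  under [in RHS]eq_Rintegral do rewrite -mulrA.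
  by rewrite !expectZ// Ec.
- under eq_Rintegral do rewrite -mulrA.
  under [in RHS]eq_Rintegral do rewrite -mulrA.
  by rewrite !expectZ// Es.
Qed.

Lemma same_fourierD h g : same_fourier h -> same_fourier g ->
  same_fourier (fun y => h y + g y).
Proof.
move=> [bh Eh] [bg Eg]; split; first exact: bounded_mfunD.
move=> x; have [hc hs] := Eh x; have [gc gs] := Eg x.
have bc := bounded_mfun_cos (measurable_dotp x).
have bs := bounded_mfun_sin (measurable_dotp x).
split.
- under eq_Rintegral do rewrite mulrDl.
  under [in RHS]eq_Rintegral do rewrite mulrDl.
  by rewrite !expectD ?hc ?gc//; exact: bounded_mfunM.
- under eq_Rintegral do rewrite mulrDl.
  under [in RHS]eq_Rintegral do rewrite mulrDl.
  by rewrite !expectD ?hs ?gs//; exact: bounded_mfunM.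
Qed.

Lemma same_fourier_lim (h_ : nat -> n.-tuple R -> R) h :
  (forall k, same_fourier (h_ k)) -> bounded_cvg h_ h -> same_fourier h.
Proof.
move=> Eh_ hh; have mh_ k : measurable_fun setT (h_ k) by case: (Eh_ k) => -[].
split; first exact: bounded_cvg_mfun hh.
have lim g : bounded_mfun g ->
    (forall k, \int[P]_y (h_ k y * g y) = \int[Q]_y (h_ k y * g y)) ->
    \int[P]_y (h y * g y) = \int[Q]_y (h y * g y).
  move=> bg E.
  have mhg k : measurable_fun setT (fun y => h_ k y * g y).
    by apply: measurable_funM => //; case: bg.
  have cP := expect_cvg (P := P) mhg (bounded_cvgM hh bg).
  have := expect_cvg (P := Q) mhg (bounded_cvgM hh bg).
  under eq_fun do rewrite -E.
  by move: cP => /cvg_lim <-// /cvg_lim <-.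
move=> x; split; apply: lim => [|k].
- by apply: bounded_mfun_cos; exact: measurable_dotp.
- by case: (Eh_ k) => _ /(_ x)[].
- by apply: bounded_mfun_sin; exact: measurable_dotp.
- by case: (Eh_ k) => _ /(_ x)[].
Qed.

Lemma multiplier_cst c : multiplier (fun=> c).
Proof.
by split; [exact: bounded_mfun_cst|move=> h Eh; exact: same_fourierZ].
Qed.

Lemma multiplierD f g : multiplier f -> multiplier g ->
  multiplier (fun y => f y + g y).
Proof.
move=> [bf Mf] [bg Mg]; split; first exact: bounded_mfunD.
move=> h Eh; have := same_fourierD (Mf _ Eh) (Mg _ Eh).
by congr same_fourier; apply/funext => y; rewrite mulrDl.
Qed.

Lemma multiplierM f g : multiplier f -> multiplier g ->
  multiplier (fun y => f y * g y).
Proof.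
move=> [bf Mf] [bg Mg]; split; first exact: bounded_mfunM.
move=> h Eh; have := Mf _ (Mg _ Eh).
by congr same_fourier; apply/funext => y; rewrite mulrA.
Qed.

Lemma multiplierN f : multiplier f -> multiplier (fun y => - f y).
Proof.
move=> mf; have := multiplierM (multiplier_cst (-1)) mf.
by congr multiplier; apply/funext => y; rewrite mulN1r.
Qed.

Lemma multiplier_lim (f_ : nat -> n.-tuple R -> R) f :
  (forall k, multiplier (f_ k)) -> bounded_cvg f_ f -> multiplier f.
Proof.
move=> Mf_ ff; have mf_ k : measurable_fun setT (f_ k) by case: (Mf_ k) => -[].
split; first exact: bounded_cvg_mfun ff.
move=> h Eh; apply: (@same_fourier_lim (fun k y => f_ k y * h y)).
  by move=> k; case: (Mf_ k) => _; apply.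
by apply: bounded_cvgM => //; case: Eh.
Qed.

Lemma multiplier_sg f : multiplier f -> (forall y, `|f y| <= 1) ->
  multiplier (fun y => Num.sg (f y)).
Proof.
move=> Mf f1; apply: (@multiplier_lim (fun k y => iter k smoothstep (f y))).
  elim=> [//|k IH] /=; rewrite /smoothstep.
  have := multiplierM (multiplierD (multiplierM (multiplier_cst 3) IH)
    (multiplierN (multiplierM IH (multiplierM IH IH)))) (multiplier_cst 2^-1).
  by congr multiplier; apply/funext => y; rewrite !exprS expr0 mulr1.
split; last by move=> y; exact: iter_smoothstep_cvg.
by exists 1 => k y; exact: iter_smoothstep_norm.
Qed.

(** Multiplying by a character translates Fourier transforms: the product formulas
for cosines and sines express the transform of [f h] at [z] by that of [h] at
[z + x] and [z - x]. *)
Lemma multiplier_trig x :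
  multiplier (fun y => cos (dotp x y)) /\ multiplier (fun y => sin (dotp x y)).
Proof.
have bc := bounded_mfun_cos (measurable_dotp x).
have bs := bounded_mfun_sin (measurable_dotp x).
have trig h z : same_fourier h -> forall c1 c2 s1 s2 : R,
    forall F, (forall y, F y = c1 * (h y * cos (dotp (tuple_comb 1 1 z x) y)) +
     c2 * (h y * cos (dotp (tuple_comb 1 (-1) z x) y)) +
     (s1 * (h y * sin (dotp (tuple_comb 1 1 z x) y)) +
     s2 * (h y * sin (dotp (tuple_comb 1 (-1) z x) y)))) ->
   \int[P]_y F y = \int[Q]_y F y.
  move=> [bh Eh] c1 c2 s1 s2 F /funext ->.
  have [cp sp] := Eh (tuple_comb 1 1 z x).
  have [cm sm] := Eh (tuple_comb 1 (-1) z x).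
  have bC w : bounded_mfun (fun y => h y * cos (dotp w y)).
    by apply: bounded_mfunM => //; apply: bounded_mfun_cos; exact: measurable_dotp.
  have bS w : bounded_mfun (fun y => h y * sin (dotp w y)).
    by apply: bounded_mfunM => //; apply: bounded_mfun_sin; exact: measurable_dotp.
  have bZ (c : R) f : bounded_mfun f -> bounded_mfun (fun y => c * f y).
    by move=> bf; apply: bounded_mfunM => //; exact: bounded_mfun_cst.
  by rewrite !expectD ?expectZ ?cp ?sp ?cm ?sm//;
    do ?apply: bounded_mfunD; apply: bZ.
have dp z y : dotp (tuple_comb 1 1 z x) y = dotp z y + dotp x y.
  by rewrite dotp_comb !mul1r.
have dm z y : dotp (tuple_comb 1 (-1) z x) y = dotp z y - dotp x y.
  by rewrite dotp_comb mul1r mulN1r.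
split; split=> // h Eh; (split; first by apply: bounded_mfunM => //; case: Eh) => z.
- split.
  + by apply: (trig h z Eh 2^-1 2^-1 0 0) => y; rewrite dp dm cosD cosB; field.
  + by apply: (trig h z Eh 0 0 2^-1 2^-1) => y; rewrite dp dm sinD sinB; field.
- split.
  + by apply: (trig h z Eh 0 0 2^-1 (- 2^-1)) => y; rewrite dp dm sinD sinB; field.
  + by apply: (trig h z Eh (- 2^-1) 2^-1 0 0) => y; rewrite dp dm cosD cosB; field.
Qed.

(** For fixed [y] the angle (y_i - a) / (k + 1) is eventually in the interval
(-1, 1), where the sine has the sign of its argument. *)
Lemma multiplier_sg_coord (i : 'I_n) (a : R) :
  multiplier (fun y => Num.sg (tnth y i - a)).
Proof.
apply: (@multiplier_lim (fun k y => Num.sg (sin ((tnth y i - a) / k.+1%:R)))).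
  move=> k; apply: multiplier_sg; last first.
    by move=> y; rewrite ler_norml sin_geN1 sin_le1.
  have [Mc Ms] := multiplier_trig (coord_vec i k.+1%:R^-1).
  have := multiplierD (multiplierM Ms (multiplier_cst (cos (a / k.+1%:R))))
    (multiplierN (multiplierM Mc (multiplier_cst (sin (a / k.+1%:R))))).
  congr multiplier; apply/funext => y.
  by rewrite mulrBl sinB !dotp_coord_vec ![k.+1%:R^-1 * _]mulrC.
split.
  by exists 1 => k y; rewrite normr_sg; case: (_ != 0).
move=> y; set t := tnth y i - a.
apply: (@cvg_near_cst _ _ _ _ _ _).
near=> k.
have tk : `|t / k.+1%:R| < 1.
  rewrite normrM normfV ltr_pdivrMr ?normr_gt0// mul1r normr_nat.
  apply: (@lt_trans _ _ k%:R); last by rewrite ltr_nat.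
  by near: k; exact: nbhs_infty_gtr.
have k0 : 0 < k.+1%:R^-1 :> R by rewrite invr_gt0.
have -> : Num.sg t = Num.sg (t / k.+1%:R) by rewrite sgrM (gtr0_sg k0) mulr1.
move: tk; move: (t / k.+1%:R) => u u1.
exact: sgr_sin.
Unshelve. all: by end_near. Qed.

Definition indic_multiplier (A : set (n.-tuple R)) := multiplier (\1_A).

Lemma indic_multiplier_sigma_algebra : sigma_algebra setT indic_multiplier.
Proof.
have MC A : indic_multiplier A -> indic_multiplier (~` A).
  move=> MA; have := multiplierD (multiplier_cst 1) (multiplierN MA).
  congr multiplier; apply/funext => y; rewrite !indicE in_setC.
  by case: (_ \in _); rewrite /= ?subrr ?subr0.
have M0 : indic_multiplier set0.
  by rewrite /indic_multiplier indic0; exact: multiplier_cst.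
have MI A B : indic_multiplier A -> indic_multiplier B ->
    indic_multiplier (A `&` B).
  move=> MA MB; have := multiplierM MA MB.
  by rewrite /indic_multiplier indicI.
split=> //; first by move=> A MA; rewrite setTD; exact: MC.
move=> F MF.
have MU k : indic_multiplier (\bigcup_(i in `I_k) F i).
  elim: k => [|k IH]; first by rewrite II0 bigcup_set0.
  rewrite IIS bigcup_setU bigcup_set1 -(setCK (_ `|` _)) setCU.
  by apply/MC/MI; exact: MC.
apply: (@multiplier_lim (fun k => \1_(\bigcup_(i in `I_k) F i))) => //.
split.
  by exists 1 => k y; rewrite indicE; case: (_ \in _); rewrite ?normr1 ?normr0.
move=> y; apply: cvg_near_cst.
have [[i _ Fiy]|nF] := pselect ((\bigcup_i F i) y).
- exists i.+1 => // k /= ik; rewrite !indicE !mem_set//; first by exists i.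
  by exists i => //; exact: ik.
- apply: nearW => k; rewrite !indicE !memNset//.
  by move=> [i _ Fiy]; apply: nF; exists i.
Qed.

(** The indicator of (0, +oo) is (sg + sg^2) / 2, so that half-spaces bounded by
coordinate hyperplanes are covered; they generate the sigma-algebra. *)
Lemma measurable_indic_multiplier A : measurable A -> indic_multiplier A.
Proof.
apply: smallest_sub; first exact: indic_multiplier_sigma_algebra.
move=> B; rewrite -bigcup_seq => -[i _ [C mC <-]]; rewrite setTI.
have [sigma0 sigmaC sigmaU] := indic_multiplier_sigma_algebra.
have pre : sigma_algebra setT
    [set D | indic_multiplier ((fun y : n.-tuple R => tnth y i) @^-1` D)].
  split=> //= [D MD|F MF]; first by rewrite setTD preimage_setC -setTD; exact: sigmaC.
  by rewrite preimage_bigcup; exact: sigmaU.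
have {mC} : (@ocitv R).-sigma.-measurable C by exact: mC.
rewrite RGenOInfty.measurableE.
apply: smallest_sub pre _ C => _ [a ->] /=.
have Ms := multiplier_sg_coord i a.
have := multiplierM (multiplier_cst 2^-1) (multiplierD Ms (multiplierM Ms Ms)).
congr multiplier; apply/funext => y; rewrite indicE /preimage/=.
have [ya|ya] := ltP a (tnth y i).
  by rewrite gtr0_sg ?subr_gt0// mem_set /= ?in_itv /= ?ya//; field.
rewrite memNset/= ?in_itv/= ?andbT ?ltNge ?ya//.
move: ya; rewrite -subr_le0 le_eqVlt => /predU1P[->|u0]; last first.
  by rewrite ltr0_sg//; field.
by rewrite sgr0; field.
Qed.

(** A multiplier [f] may be applied to the constant 1, whose Fourier transforms
agree by hypothesis; evaluating at frequency 0 gives equal expectations of [f]. *)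
Lemma trig_uniqueness A : measurable A -> P A = Q A.
Proof.
move=> mA; have [_ /(_ _ same_fourier1)[bA]] := measurable_indic_multiplier mA.
move=> /(_ [tuple 0 | i < n])[+ _].
have d0 y : dotp [tuple 0 | i < n] y = 0 :> R.
  by rewrite /dotp big1// => i _; rewrite tnth_mktuple mul0r.
under eq_Rintegral do rewrite d0 cos0 !mulr1.
under [in RHS]eq_Rintegral do rewrite d0 cos0 !mulr1.
rewrite /Rintegral !integral_indic// !setIT => E.
by rewrite -[LHS]fineK ?fin_num_measure// E fineK// fin_num_measure.
Qed.

End fourier_uniqueness.

(** * Fourier transforms of products of marginals *)

Section fourier_product.
Local Open Scope complex_scope.
Context {R : realType}.

Lemma expect_product d1 d2 (T1 : measurableType d1) (T2 : measurableType d2)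
    (m1 : probability T1 R) (m2 : probability T2 R) (f : T1 -> R) (g : T2 -> R) :
  bounded_mfun f -> bounded_mfun g ->
  \int[(m1 \x m2)%E]_z (f z.1 * g z.2) = (\int[m1]_t f t) * (\int[m2]_t g t).
Proof.
move=> bf bg.
have bfst := bounded_mfun_comp (@measurable_fst _ _ T1 T2) bf.
have bsnd := bounded_mfun_comp (@measurable_snd _ _ T1 T2) bg.
have ifg := bounded_mfun_integrable (m1 \x m2)%E (bounded_mfunM bfst bsnd).
rewrite {1}/Rintegral -(integral12_prod_meas1 ifg) /fubini_F/=.
rewrite -RintegralZr//; last exact: bounded_mfun_integrable.
congr fine; apply: eq_integral => t _.
rewrite -RintegralZl//; last exact: bounded_mfun_integrable.
rewrite fineK//; apply: integrable_fin_num => //.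
apply: (bounded_mfun_integrable m2).
by apply: bounded_mfunM => //; exact: bounded_mfun_cst.
Qed.

(** The expectation of exp(- i g). *)
Definition expect_cis d (T : measurableType d) (mu : {measure set T -> \bar R})
    (g : T -> R) : R[i] :=
  (\int[mu]_t cos (g t)) -i* (\int[mu]_t sin (g t)).

Lemma expect_cis_distribution d1 d2 (T1 : measurableType d1)
    (T2 : measurableType d2) (P : probability T1 R) (X : {RV P >-> T2})
    (g : T2 -> R) : measurable_fun setT g ->
  expect_cis (distribution P X) g = expect_cis P (g \o X).
Proof.
move=> mg; have push f : bounded_mfun f ->
    \int[distribution P X]_t f t = \int[P]_t (f (X t)).
  move=> bf; rewrite /Rintegral integral_distribution//.
    by case: bf => mf _; exact/measurable_EFinP.
  by apply: bounded_mfun_integrable; exact: bounded_mfun_comp.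
by rewrite /expect_cis !push//; [exact: bounded_mfun_sin|exact: bounded_mfun_cos].
Qed.

Lemma expect_cis_product d1 d2 (T1 : measurableType d1) (T2 : measurableType d2)
    (m1 : probability T1 R) (m2 : probability T2 R) (g : T1 -> R) (h : T2 -> R) :
  measurable_fun setT g -> measurable_fun setT h ->
  expect_cis (m1 \x m2)%E (fun z => g z.1 + h z.2) =
  expect_cis m1 g * expect_cis m2 h.
Proof.
move=> mg mh; rewrite /expect_cis.
have bcg := bounded_mfun_cos mg; have bsg := bounded_mfun_sin mg.
have bch := bounded_mfun_cos mh; have bsh := bounded_mfun_sin mh.
have b1 := bounded_mfun_comp (R := R) (@measurable_fst _ _ T1 T2).
have b2 := bounded_mfun_comp (R := R) (@measurable_snd _ _ T1 T2).
under eq_Rintegral do rewrite cosD.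
under [X in _ -i* X]eq_Rintegral do rewrite sinD.
rewrite (@expectB _ _ _ (m1 \x m2)%E); first last.
- exact: bounded_mfunM (b1 _ bsg) (b2 _ bsh).
- exact: bounded_mfunM (b1 _ bcg) (b2 _ bch).
rewrite (@expectD _ _ _ (m1 \x m2)%E); first last.
- exact: bounded_mfunM (b1 _ bcg) (b2 _ bsh).
- exact: bounded_mfunM (b1 _ bsg) (b2 _ bch).
rewrite (expect_product m1 m2 bcg bch) (expect_product m1 m2 bsg bsh).
rewrite (expect_product m1 m2 bsg bch) (expect_product m1 m2 bcg bsh).
by apply/eqP; rewrite eq_complex /=; apply/andP; split; apply/eqP; ring.
Qed.

Lemma fourier_expect_cis n (P : probability (n.-tuple R) R) x :
  fourier_transform P x = expect_cis P (dotp x).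
Proof.
rewrite /fourier_transform /cintegral /expect_cis.
have E t : cexp (- ('i * t%:C)) = cos t -i* sin t :> R[i].
  rewrite /cexp/= !(mul0r, mul1r, mulr0, subrr, add0r, oppr0) expR0 !mul1r.
  by rewrite cosN sinN.
congr (_ +i* _).
  by apply: eq_Rintegral => t _; rewrite E.
transitivity (\int[P]_t (- 1 * sin (dotp x t))).
  by apply: eq_Rintegral => t _; rewrite E mulN1r.
rewrite expectZ ?mulN1r//.
by apply: bounded_mfun_sin; exact: measurable_dotp.
Qed.

Lemma dotp_coord_proj n (F : {set 'I_n}) (x y : n.-tuple R) :
  dotp (coord_proj F x) (coord_proj F y) = dotp (restrict_tuple F x) y.
Proof.
rewrite dotp_restrict big_enum_val/=; apply: eq_bigr => j _.
by rewrite !tnth_mktuple.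
Qed.

(** The exponent splits as a function of the first factor plus a function of the
second one, which is what makes the Fourier transform multiplicative. *)
Lemma dotp_glue n (F : {set 'I_n}) (x : n.-tuple R) u v :
  dotp x (@Defs.glue R n F (u, v)) =
  dotp (coord_proj F x) u + dotp (restrict_tuple (finset.setC F) x) v.
Proof.
rewrite dotp_restrict [LHS](bigID (mem F))/=; congr (_ + _).
  rewrite big_enum_val/=; apply: eq_bigr => j _.
  by rewrite !tnth_mktuple enum_valP index_enum_val -tnth_nth.
rewrite [RHS](eq_bigl (fun i => i \notin F)); last by move=> i; rewrite inE.
by apply: eq_bigr => i iF; rewrite tnth_mktuple (negPf iF).
Qed.

Lemma fourier_glue n (P Q : probability (n.-tuple R) R) (F : {set 'I_n}) x :
  fourier_transform (distribution (marginal P F \x Q)%E (@Defs.glue R n F)) x =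
  fourier_transform P (restrict_tuple F x) *
  fourier_transform Q (restrict_tuple (finset.setC F) x).
Proof.
rewrite !fourier_expect_cis expect_cis_distribution; last exact: measurable_dotp.
have -> : dotp x \o (@Defs.glue R n F) = (fun z => dotp (coord_proj F x) z.1 +
    dotp (restrict_tuple (finset.setC F) x) z.2).
  by apply/funext => -[u v]; exact: dotp_glue.
rewrite expect_cis_product; [|exact: measurable_dotp..].
rewrite expect_cis_distribution; last exact: measurable_dotp.
congr (expect_cis _ _ * _).
by apply/funext => y /=; exact: dotp_coord_proj.
Qed.

(** The Dirac mass at 0 that starts the recursion contributes the factor
exp(0) = 1, whichever coordinates [s] leaves uncovered. *)
Lemma fourier_marginal_prod n (P : probability (n.-tuple R) R)
    (s : seq {set 'I_n}) x :
  pairwise (fun F G : {set 'I_n} => [disjoint F & G]%B) s ->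
  fourier_transform (marginal_prod P s) x =
  \prod_(F <- s) fourier_transform P (restrict_tuple F x).
Proof.
elim: s x => [|F s IH] x /=.
  move=> _; rewrite big_nil fourier_expect_cis /expect_cis.
  rewrite /Rintegral !integral_dirac//; last 2 first.
  - by apply/measurable_EFinP; have [] := bounded_mfun_sin (measurable_dotp x).
  - by apply/measurable_EFinP; have [] := bounded_mfun_cos (measurable_dotp x).
  rewrite !diracT !mul1e /=.
  have -> : dotp x [tuple 0 | _ < n] = 0.
    by rewrite /dotp big1// => i _; rewrite tnth_mktuple mulr0.
  by rewrite cos0 sin0 oppr0.
move=> /andP[/allP dF ds]; rewrite big_cons fourier_glue IH//; congr (_ * _).
apply: eq_big_seq => G Gs; congr (fourier_transform _ _).
apply: eq_from_tnth => i; rewrite !tnth_mktuple inE.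
by case: ifP => // iG; rewrite (disjointFl (dF _ Gs) iG).
Qed.

Lemma fourier_part_prod n (P : probability (n.-tuple R) R) (pi : setpart n) x :
  fourier_transform (part_prod P pi) x =
  \prod_(F in val pi) fourier_transform P (restrict_tuple F x).
Proof.
have /finset.trivIsetP triv := setpart_trivIset pi.
rewrite /part_prod fourier_marginal_prod ?big_enum//.
have : uniq (enum (val pi)) by exact: enum_uniq.
rewrite uniq_pairwise.
apply: (@sub_in_pairwise _ (mem (val pi))); first by move=> F G /=; exact: triv.
by apply/allP => F; rewrite mem_enum.
Qed.

End fourier_product.

(** * Gaussian measures and set partitions *)

(** The hypothesis passes from powers to all polynomials; evaluate it at one that
vanishes at every [r i] except [r i0]. *)
Lemma power_sums_eq0 (K : idomainType) (I : finType) (A : {set I})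
    (c r : I -> K) (i0 : I) :
  i0 \in A -> (forall i, i \in A -> i != i0 -> r i != r i0) ->
  (forall k, \sum_(i in A) c i * r i ^+ k = 0) -> c i0 = 0.
Proof.
move=> i0A neq pow0.
pose p := \prod_(i in A | i != i0) ('X - (r i)%:P).
have sum0 : \sum_(i in A) c i * p.[r i] = 0.
  under eq_bigr do rewrite horner_coef mulr_sumr.
  rewrite exchange_big/= big1// => k _.
  transitivity (p`_k * \sum_(i in A) c i * r i ^+ k); last by rewrite pow0 mulr0.
  by rewrite mulr_sumr; apply: eq_bigr => i _; ring.
move: sum0; rewrite (bigD1 i0)//= big1 ?addr0 => [/eqP|i /andP[iA ii0]].
  rewrite mulf_eq0 => /orP[/eqP//|]; rewrite horner_prod.
  move=> /prodf_eq0[i /andP[iA ii0]].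
  rewrite hornerXsubC subr_eq0 eq_sym.
  by rewrite (negPf (neq _ iA ii0)).
rewrite horner_prod (bigD1 i) ?iA//= hornerXsubC subrr mul0r mulr0//.
Qed.

Lemma cos_sin_mul_eq0 {R : realType} (s t : R) :
  s * cos t = 0 -> s * sin t = 0 -> s = 0.
Proof.
move=> sc0 ss0; have : s * cos t * cos t + s * sin t * sin t = 0.
  by rewrite sc0 ss0 !mul0r addr0.
by rewrite -!mulrA -mulrDr -!expr2 cos2Dsin2 mulr1.
Qed.

Section gaussian_partition.
Context {R : realType} {n : nat}.
Variables (omega : n.-tuple R) (Sigma : 'M[R]_n) (N : probability (n.-tuple R) R).
Hypothesis gaussN : is_gaussian omega Sigma N.
Implicit Types (x y : n.-tuple R) (pi sigma : setpart n).

(** These are the real and imaginary parts of the statement that the product of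
the marginals of N(omega, Sigma) along [pi] is N(omega, Sigma_pi). *)
Lemma trig_part_prod pi x :
  let a := expR (- quadf (block_restrict Sigma pi) x / 2) in
  \int[part_prod N pi]_y cos (dotp x y) = a * cos (dotp x omega) /\
  \int[part_prod N pi]_y sin (dotp x y) = a * sin (dotp x omega).
Proof.
move=> a; have [_ FN] := gaussN.
have cexpE (t q : R) : cexp (- ('i%C * t%:C%C) - (q / 2)%:C%C) =
    (expR (- q / 2) * cos t -i* (expR (- q / 2) * sin t))%C.
  rewrite /cexp/= !(mul0r, mul1r, mulr0, subrr, add0r, addr0, oppr0, subr0) cosN sinN.
  by rewrite mulrN mulNr.
have prodE (I : finType) (A : {pred I}) (q t : I -> R) :
    \prod_(F in A) (expR (- q F / 2) * cos (t F) -i* (expR (- q F / 2) * sin (t F)))%C =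
    (expR (- (\sum_(F in A) q F) / 2) * cos (\sum_(F in A) t F) -i*
    (expR (- (\sum_(F in A) q F) / 2) * sin (\sum_(F in A) t F)))%C.
  elim/big_rec3: _ => [|F q' t' z _ ->].
    by rewrite oppr0 mul0r expR0 cos0 sin0 mulr0 oppr0 mulr1.
  rewrite opprD mulrDl expRD cosD sinD.
  by apply/eqP; rewrite eq_complex /=; apply/andP; split; apply/eqP; ring.
have := fourier_part_prod N pi x; rewrite fourier_expect_cis.
under eq_bigr do rewrite FN cexpE.
rewrite prodE sum_dotp_restrict sum_quadf_restrict.
by move=> /eqP; rewrite eq_complex => /andP[/eqP/= -> /eqP/= /oppr_inj ->].
Qed.

Lemma part_prod_gaussian_eq pi sigma A :
  block_restrict Sigma pi = block_restrict Sigma sigma -> measurable A ->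
  part_prod N pi A = part_prod N sigma A.
Proof.
move=> E; apply: trig_uniqueness => x;
  have [c1 s1] := trig_part_prod pi x; have [c2 s2] := trig_part_prod sigma x.
- by rewrite c1 c2 E.
- by rewrite s1 s2 E.
Qed.

End gaussian_partition.

Section signed_combination.
Context d (T : measurableType d) {R : realType}.

(** Moving the terms with a negative coefficient to the other side gives an
equality of two positive measures, hence of integrals of nonnegative functions; a
bounded function becomes nonnegative after adding a constant. *)
Lemma sum_expect_eq0 (I : finType) (A : {set I}) (i0 : I) (c : I -> R)
    (P : I -> probability T R) :
  (forall B, measurable B -> \sum_(i in A) c i * fine (P i B) = 0) ->
  forall f, bounded_mfun f -> \sum_(i in A) c i * \int[P i]_t f t = 0.
Proof.
move=> c0; pose cN i := - c i.
pose e k := nth i0 (enum A) k; pose m := #|A|.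
have enumE (F : I -> R) : \sum_(i in A) F i = \sum_(k < m) F (e k).
  by rewrite -big_enum (big_nth i0) big_mkord /m cardE.
have max0 (b : R) : 0 <= Num.max b 0 by rewrite le_max lexx orbT.
pose mu (b : I -> R) : {measure set T -> \bar R} :=
  msum (fun k => mscale (NngNum (max0 (b (e k)))) (P (e k))) m.
have maxE (b : R) : Num.max b 0 - Num.max (- b) 0 = b.
  by rewrite /Num.max oppr_lt0; case: ltgtP => [b0|b0|->]; ring.
have muE B : measurable B -> mu c B = mu cN B.
  move=> mB; have muB b : mu b B =
      (\sum_(k < m) Num.max (b (e k)) 0 * fine (P (e k) B))%:E.
    rewrite -sumEFin; apply: eq_bigr => k _.
    by rewrite EFinM fineK ?fin_num_measure.
  rewrite !muB; congr _%:E; apply/eqP; rewrite -subr_eq0 -sumrB.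
  rewrite -[X in _ == X](c0 B mB) enumE; apply/eqP; apply: eq_bigr => k _.
  by rewrite -mulrBl maxE.
have pos f : bounded_mfun f -> (forall t, 0 <= f t) ->
    \sum_(i in A) c i * \int[P i]_t f t = 0.
  move=> bf f0; have mf : measurable_fun setT (EFin \o f).
    by case: bf => mf _; exact/measurable_EFinP.
  have intE b : (\int[mu b]_t (f t)%:E)%E =
      (\sum_(k < m) Num.max (b (e k)) 0 * \int[P (e k)]_t f t)%:E.
    rewrite ge0_integral_measure_sum//; last by move=> t _; rewrite lee_fin.
    rewrite -sumEFin; apply: eq_bigr => k _.
    rewrite ge0_integral_mscale//; last by move=> t _; rewrite lee_fin.
    rewrite EFinM /Rintegral fineK//; apply: integrable_fin_num => //.
    exact: bounded_mfun_integrable.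
  have : (\int[mu c]_t (f t)%:E = \int[mu cN]_t (f t)%:E)%E.
    by apply: eq_measure_integral => B mB _; exact: muE.
  rewrite !intE => -[/eqP]; rewrite -subr_eq0 -sumrB => /eqP int0.
  rewrite -[RHS]int0 enumE; apply: eq_bigr => k _.
  by rewrite -mulrBl maxE.
move=> f bf; have [_ [M fM]] := bf.
have bM := @bounded_mfun_cst _ T R `|M|.
have := pos _ (bounded_mfunD bf bM).
under eq_bigr do rewrite expectD// mulrDr.
rewrite big_split/= (pos _ bM)// addr0; apply=> t.
rewrite -lerBlDr sub0r; have := fM t; rewrite ler_norml => /andP[+ _].
by apply: le_trans; rewrite lerN2 ler_norm.
Qed.

End signed_combination.

Theorem theorem7p4 (R : realType) (n : nat) (omega : n.-tuple R)
    (Sigma : 'M[R]_n) (N : probability (n.-tuple R) R)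
    (gaussN : is_gaussian omega Sigma N)
    (T : {set setpart n}) (lowerT : lower_set T) :
  (forall A : set (n.-tuple R), measurable A -> lower_set_measure T N A = 0%E) <->
  (exists2 pi : setpart n,
     pi \in T /\ pi <> \top%O & Sigma = block_restrict Sigma pi).
Proof.
have [_ topT lowT] := lowerT.
pose c pi : R := (moebius T pi \top%O)%:~R.
have measE A : measurable A -> lower_set_measure T N A =
    (\sum_(pi in T) c pi * fine (part_prod N pi A))%:E.
  move=> mA; rewrite -sumEFin; apply: eq_bigr => pi _.
  by rewrite EFinM fineK ?fin_num_measure.
split=> [TN0|[pi [piT /eqP pitop] SigmaE] A mA].
  apply: contrapT => noblock.
  have [[SigmaT _] _] := gaussN.
  pose D pi := Sigma - block_restrict Sigma pi.
  (* A direction in which the top partition is separated from all others. *)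
  have [E|x xgen] := @exists_generic_vec R n [seq D pi | pi <- enum (T :\ \top%O)%SET].
    move=> /mapP[pi]; rewrite mem_enum !inE => /andP[pitop piT] ->.
    split; first by rewrite linearB/= block_restrict_tr SigmaT.
    rewrite subr_eq0; apply/eqP => SigmaE; apply: noblock.
    by exists pi => //; split=> //; exact/eqP.
  pose q pi y := quadf (block_restrict Sigma pi) y.
  have exp0 y : \sum_(pi in T) c pi * expR (- q pi y / 2) = 0.
    have int0 := @sum_expect_eq0 _ _ R _ T \top%O c (part_prod N) _.
    have {}int0 f : bounded_mfun f ->
        \sum_(pi in T) c pi * \int[part_prod N pi]_z f z = 0.
      by apply: int0 => A mA; have := TN0 A mA; rewrite measE// => -[].
    have := int0 _ (bounded_mfun_cos (measurable_dotp y)).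
    have := int0 _ (bounded_mfun_sin (measurable_dotp y)).
    under eq_bigr do rewrite (trig_part_prod gaussN _ _).2 mulrA.
    rewrite -mulr_suml => s0.
    under eq_bigr do rewrite (trig_part_prod gaussN _ _).1 mulrA.
    rewrite -mulr_suml => c0.
    exact: cos_sin_mul_eq0 c0 s0.
  suff /eqP : c \top%O = 0 by rewrite /c moebiusxx oner_eq0.
  apply: (@power_sums_eq0 _ _ T c (fun pi => expR (- q pi x / 2)) \top%O topT).
    move=> pi piT pitop; apply: contraNneq (xgen (D pi) _); last first.
      by apply/mapP; exists pi => //; rewrite mem_enum !inE pitop.
    move=> /expR_inj /(mulIf _) /oppr_inj; rewrite /q block_restrict_top => qE.
    by rewrite quadfB qE ?subrr// invr_eq0.
  (* Scaling x by sqrt k multiplies the quadratic forms by k. *)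
  move=> k; rewrite -[RHS](exp0 (tuple_comb (Num.sqrt k%:R) 0 x x)).
  apply: eq_bigr => pi _; rewrite -expRM_natl /q quadf_comb sqr_sqrtr//.
  by congr (_ * expR _); ring.
rewrite measE//; congr _%:E.
pose g sigma := fine (part_prod N sigma A).
transitivity (\sum_(sigma in T) c sigma * g (setpart_meet sigma pi)).
  apply: eq_bigr => sigma _; congr (_ * fine _).
  apply: (part_prod_gaussian_eq gaussN) => //.
  by rewrite -block_restrict_meet -SigmaE.
apply: (@sum_moebius_meet _ _ _ _ _ pi (fun s => setpart_meet s pi)) => //.
- move=> s _; apply: (lowT pi); first by rewrite !inE pitop.
  by have := lexx (setpart_meet s pi); rewrite le_setpart_meet => /andP[].
- by move=> t s _ _; exact: le_setpart_meet.
Qed.
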